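(* Let $k$ be a positive integer. Consider the pairs $(r,l)$ of positive integers such that $r\le l$ and either $1\le r\le k+2$ or $k+1+\left\lceil\frac{k+1}{2}\right\rceil\le r$. Then for all but finitely many of these pairs $(r,l)$ the grid graph $G_{r,l}$ is $k$-distance domatically-full, i.e. $d_k(G_{r,l})=\delta_k(G_{r,l})$.
   Context: For positive integers $s,t$, the grid graph $G_{s,t}$ has vertex set $\{(i,j)\in\mathbb{Z}^2: 1\le i\le s,\ 1\le j\le t\}$, with $(a,b)$ and $(c,d)$ adjacent iff $|a-c|+|b-d|=1$. For a graph $G$, $d(x,y)$ denotes the graph distance (length of a shortest path), with $d(x,x)=0$. For a positive integer $k$, $f_k(x)=|\{y\in V(G): d(x,y)\le k\}|$ (note that $x$ itself is counted), and $\delta_k(G)=\min_{x\in V(G)}f_k(x)$. A proper $k$-distance domatic coloring with $t$ colors is a map $c:V(G)\to\{1,\dots,t\}$ such that for each vertex $x$ and each color $i\in\{1,\dots,t\}$ there is a vertex $y$ with $d(x,y)\le k$ and $c(y)=i$. The $k$-distance domatic number $d_k(G)$ is the maximum $t$ for which such a coloring exists. One always has $d_k(G)\le\delta_k(G)$, and $G$ is called $k$-distance domatically-full if $d_k(G)=\delta_k(G)$. *)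

(* Defs.v *)
From mathcomp Require Import all_boot all_order all_algebra.

Set Implicit Arguments.
Unset Strict Implicit.
Unset Printing Implicit Defensive.

(* A graph is given by its adjacency relation [e] on a finite type of          *)
(* vertices.                                                                   *)

Definition walk (T : finType) (e : rel T) (n : nat) (x y : T) : bool :=
  [exists p : n.-tuple T, path e x p && (last x p == y)].

(* The least length of a walk from x to y. Searching below #|T| is enough,     *)
(* since a shortest walk repeats no vertex; the junk value #|T| is returned    *)
(* exactly when y cannot be reached from x (see gdist_walk, gdist_min).        *)
Definition gdist (T : finType) (e : rel T) (x y : T) : nat :=
  find (fun n => walk e n x y) (iota 0 #|T|).

(* d(x,y) <= k, where d(x,y) is infinite when x and y are not connected.       *)
Definition within (T : finType) (e : rel T) (k : nat) (x y : T) : bool :=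
  connect e x y && (gdist e x y <= k).

Definition ball_card (T : finType) (e : rel T) (k : nat) (x : T) : nat :=
  #|[set y | within e k x y]|.

(* The neutral value #|T| bounds every ball_card, so on a nonempty graph this  *)
(* is the true minimum.                                                        *)
Definition min_ball_card (T : finType) (e : rel T) (k : nat) : nat :=
  \big[minn/#|T|]_(x : T) ball_card e k x.

Definition domatic_coloring (T : finType) (e : rel T) (k t : nat)
    (c : {ffun T -> 'I_t}) : bool :=
  [forall x : T, forall i : 'I_t, exists y : T, within e k x y && (c y == i)].

Definition domatic_colorable (T : finType) (e : rel T) (k t : nat) : bool :=
  [exists c : {ffun T -> 'I_t}, domatic_coloring e k c].

(* On a nonempty graph every color is used, so t <= #|T| loses nothing         *)
(* (see domatic_colorable_leq).                                                *)
Definition domatic_number (T : finType) (e : rel T) (k : nat) : nat :=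
  \max_(t < #|T|.+1 | domatic_colorable e k t) t.

Definition domatically_full (T : finType) (e : rel T) (k : nat) : Prop :=
  domatic_number e k = min_ball_card e k.

(* Coordinates are numbered from 0 instead of 1; `|m - n|%N is the absolute    *)
(* difference of natural numbers (a signed, not a truncated, subtraction).     *)
Definition grid (s t : nat) : rel ('I_s * 'I_t) :=
  fun u v => (`|u.1 - v.1| + `|u.2 - v.2| == 1)%N.

Lemma walkP (T : finType) (e : rel T) (n : nat) (x y : T) :
  reflect (exists p : seq T, [/\ path e x p, last x p = y & size p = n])
          (walk e n x y).
Proof.
apply: (iffP existsP) => [[p /andP[ep /eqP py]]|[p [ep py sp]]].
  by exists p; rewrite size_tuple.
by move/eqP: sp => sp; exists (Tuple sp); rewrite ep py eqxx.
Qed.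

Lemma gdist_walk (T : finType) (e : rel T) (x y : T) :
  connect e x y -> gdist e x y < #|T| /\ walk e (gdist e x y) x y.
Proof.
move=> /connectP[p0 ep0 yE]; move: yE; case/shortenP: ep0 => p ep up _ yE.
have hasw : has (fun n => walk e n x y) (iota 0 #|T|).
  apply/hasP; exists (size p); last by apply/walkP; exists p.
  by rewrite mem_iota add0n; have := max_card (mem (x :: p)); rewrite (card_uniqP up).
have lt : gdist e x y < #|T| by rewrite -[X in _ < X](size_iota 0 #|T|) -has_find.
by split=> //; have := nth_find 0 hasw; rewrite nth_iota.
Qed.

Lemma gdist_min (T : finType) (e : rel T) (x y : T) (n : nat) :
  walk e n x y -> gdist e x y <= n.
Proof.
move=> w; rewrite leqNgt; apply/negP => lt.
have := before_find 0 lt; rewrite nth_iota ?add0n ?w //.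
by apply: leq_trans lt _; rewrite -[X in _ <= X](size_iota 0 #|T|) find_size.
Qed.

Lemma domatic_colorable_leq (T : finType) (e : rel T) (k t : nat) (x : T) :
  domatic_colorable e k t -> t <= #|T|.
Proof.
move=> /existsP[c /forallP/(_ x)/forallP cP].
rewrite -[t]card_ord; apply: leq_trans (leq_image_card c predT).
apply/subset_leq_card/subsetP => i _.
by have /existsP[y /andP[_ /eqP <-]] := cP i; apply: image_f.
Qed.

(* Main.v *)
Require Import Defs.
From mathcomp Require Import all_boot all_order all_algebra.
From mathcomp Require Import zify.

Set Implicit Arguments.
Unset Strict Implicit.
Unset Printing Implicit Defensive.

(** Since t colors need balls of at least t vertices, it is enough to color the
    grid with as many colors as there are vertices in the ball of one corner;
    that this ball is a smallest one then comes for free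
    ([domatically_full_of_ball]).

    The building block is an s x p grid with s + p = 2k + 3, whose color classes
    are the pairs {y, y'} exchanged by the half-turn of the block.  The distances
    from any vertex x to y and to y' add up to at most (s - 1) + (p - 1) = 2k + 1,
    so one of them is at most k and x sees every color ([reflect_within]).
    Likewise, of the two distances from the corner, exactly one is at most k: each
    class has exactly one representative in the ball of the corner, and the
    vertices of this ball can serve as the colors.

    A larger grid is handled by folding it onto such a block.  A map g1 from rows
    to rows of the block and a map g2 from columns to columns of the block pull
    the block coloring back.  This works as soon as every row lies in an interval
    of s rows on which g1 is a bijection commuting with the reversals of the
    interval and of the block, and similarly for the columns with p: the product
    of two such intervals is a recolored copy of the block
    ([domatically_full_mirror_covered]).  Two such intervals of length p may
    overlap, by up to half of their length, because the color pairs met by the end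
    of one are not yet matched inside the beginning of the other.  Hence a folding
    exists in length p and in every length at least p + ceil (p / 2)
    ([exists_mirror_covered]).

    For r <= k + 2, rows are not folded (s = r, p = 2k + 3 - r); for larger r,
    blocks with s = k + 1 and p = k + 2 are used, and k + 1 + ceil ((k + 1) / 2) is
    just the length from which rows can be folded.  The finitely many exceptions
    are grids with too few columns to be folded. *)

(** * Domatic fullness from the ball of one vertex *)

Lemma domatic_colorable_le_ball (T : finType) (e : rel T) (k t : nat) (x : T) :
  domatic_colorable e k t -> t <= ball_card e k x.
Proof.
move=> /existsP[c /forallP/(_ x)/forallP cP].
rewrite -[t]card_ord; apply: leq_trans (leq_imset_card c _).
apply/subset_leq_card/subsetP => i _; have /existsP[y /andP[xy /eqP <-]] := cP i.
by apply: imset_f; rewrite inE.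
Qed.

Lemma min_ball_card_le (T : finType) (e : rel T) (k : nat) (x : T) :
  min_ball_card e k <= ball_card e k x.
Proof.
rewrite /min_ball_card; have := mem_index_enum x.
elim: (index_enum T) => // y s IHs; rewrite inE big_cons => /predU1P[<-|/IHs le_s].
  exact: geq_minl.
exact: leq_trans (geq_minr _ _) le_s.
Qed.

Lemma domatically_full_of_ball (T : finType) (e : rel T) (k : nat) (x : T) :
  domatic_colorable e k (ball_card e k x) -> domatically_full e k.
Proof.
move=> col; apply/eqP; rewrite eqn_leq; apply/andP; split.
  apply/bigmax_leqP => t colt; rewrite /min_ball_card.
  elim/big_ind: _ => [|m n tm tn|y _]; first by rewrite -ltnS.
    by rewrite leq_min tm.
  exact: domatic_colorable_le_ball colt.
apply: leq_trans (min_ball_card_le e k x) _.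
have ltT : ball_card e k x < #|T|.+1 by rewrite ltnS max_card.
exact: (leq_bigmax_cond (Ordinal ltT)).
Qed.

(** The vertices of the ball of [x0] themselves serve as colors, so no formula for
    the size of this ball is needed. *)
Lemma domatic_colorable_ball (T : finType) (e : rel T) (k : nat) (x0 : T)
    (f : T -> T) :
  within e k x0 x0 ->
  (forall x q, within e k x0 q -> exists2 y, within e k x y & f y = q) ->
  domatic_colorable e k (ball_card e k x0).
Proof.
move=> x0x0 fP; have x0B : x0 \in [set y | within e k x0 y] by rewrite inE.
apply/existsP; exists [ffun y => enum_rank_in x0B (f y)].
apply/forallP => x; apply/forallP => i; apply/existsP.
have := enum_valP i; rewrite inE => /(fP x)[y xy fy].
by exists y; rewrite xy ffunE fy enum_valK_in eqxx.
Qed.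

(** * Distance in the grid *)

Definition manhattan (r l : nat) (x y : 'I_r * 'I_l) : nat :=
  `|x.1 - y.1| + `|x.2 - y.2|.

Lemma manhattan_le_path (r l : nat) (x : 'I_r * 'I_l) p :
  path (@grid r l) x p -> manhattan x (last x p) <= size p.
Proof.
elim: p x => [|y p IHp] x /=; first by rewrite /manhattan; lia.
move=> /andP[/eqP xy /IHp]; rewrite /manhattan; lia.
Qed.

Lemma manhattan_step (r l n : nat) (x y : 'I_r * 'I_l) :
  manhattan x y = n.+1 -> exists2 z, grid x z & manhattan z y = n.
Proof.
case: x y => [x1 x2] [y1 y2]; rewrite /manhattan /grid /=.
have [x1r x2l y1r y2l] :=
  And4 (ltn_ord x1) (ltn_ord x2) (ltn_ord y1) (ltn_ord y2).
case: (ltngtP x1 y1) => [lt|lt|eq1] xy.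
- have zr : x1.+1 < r by lia.
  by exists (Ordinal zr, x2) => /=; lia.
- have zr : x1.-1 < r by lia.
  by exists (Ordinal zr, x2) => /=; lia.
case: (ltnP x2 y2) => lt.
- have zl : x2.+1 < l by lia.
  by exists (x1, Ordinal zl) => /=; lia.
- have zl : x2.-1 < l by lia.
  by exists (x1, Ordinal zl) => /=; lia.
Qed.

Lemma walk_manhattan (r l : nat) (x y : 'I_r * 'I_l) :
  walk (@grid r l) (manhattan x y) x y.
Proof.
apply/walkP; move nE: (manhattan x y) => n; elim: n x nE => [|n IHn] x.
  case: x y => [x1 x2] [y1 y2]; rewrite /manhattan /= => xy0.
  by exists [::]; split=> //=; congr pair; apply: val_inj => /=; lia.
move=> /manhattan_step[z xz /IHn[p [zp pl ps]]].
by exists (z :: p); rewrite /= xz ps.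
Qed.

Lemma within_grid (r l k : nat) (x y : 'I_r * 'I_l) :
  within (@grid r l) k x y = (manhattan x y <= k).
Proof.
have w := walk_manhattan x y.
have cxy : connect (@grid r l) x y.
  by case/walkP: w => p [xp <- _]; apply/connectP; exists p.
rewrite /within cxy /=; suff -> : gdist (@grid r l) x y = manhattan x y by [].
apply/eqP; rewrite eqn_leq gdist_min //=.
by have [_ /walkP[p [xp <- <-]]] := gdist_walk cxy; apply: manhattan_le_path.
Qed.

(** * Folding a segment by mirrored windows *)

(** The window [a, a + n] is mapped onto [0, n] so that its reversal
    y |-> 2a + n - y becomes the reversal x |-> n - x: mirror pairs of the window
    go to mirror pairs.  Values of [g] outside the window are not constrained. *)
Definition mirrored (n : nat) (g : nat -> nat) (a : nat) : Prop :=
  forall x, x <= n ->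
    exists2 y, a <= y <= a + n & g y = x /\ g (a.*2 + n - y) = n - x.

Definition mirror_covered (n : nat) (g : nat -> nat) (r : nat) : Prop :=
  forall i, i < r ->
    exists2 a, a <= i <= a + n & a + n < r /\ mirrored n g a.

Lemma mirrored_id n : mirrored n id 0.
Proof. by move=> x xn; exists x => //; split=> //; lia. Qed.

Lemma mirror_covered_id n : mirror_covered n id n.+1.
Proof. by move=> i lti; exists 0 => //; split=> //; apply: mirrored_id. Qed.

(** The identity on [0, n], continued so that [m, m + n] is mirrored too.  Writing
    r = n - m, the positions m, ..., n common to both windows have values above r;
    mirroring them in the second window forces the last positions
    2m, ..., m + n to take the values 0, ..., r.  What is left between them,
    n + 1, ..., 2m - 1, receives the values r + 1, ..., m - 1, a set that is its own
    mirror image. *)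
Definition two_windows (n m i : nat) : nat :=
  if i <= n then i else if i < m.*2 then i - m else i - m.*2.

(** The hypothesis [n < m.*2] says that at most half of the window overlaps the
    previous one, so that no two common positions are mirror images of each other
    in either window. *)
Lemma mirrored_two_windows n m :
  n < m.*2 -> m <= n.+1 -> mirrored n (two_windows n m) m.
Proof.
move=> ltnm lemn x lexn; rewrite /two_windows.
exists (if m <= x then x else if n < x + m then x + m else x + m.*2).
  by repeat case: ifP; lia.
by split; repeat case: ifP; lia.
Qed.

(** The values of [g] on its last window relabel [two_windows]; since this
    relabelling commutes with reversal, the window added by [two_windows] stays
    mirrored. *)
Lemma mirror_covered_extend n m a g :
  n < m.*2 -> m <= n.+1 ->
  mirror_covered n g (a + n).+1 -> mirrored n g a ->
  exists g', mirror_covered n g' (a + m + n).+1 /\ mirrored n g' (a + m).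
Proof.
move=> ltnm lemn gcov ga.
pose g' i := if i <= a + n then g i else g (a + two_windows n m (i - a)).
have g'E y : g' (a + y) = g (a + two_windows n m y).
  by rewrite /g' addKn leq_add2l; case: leqP => [yn|//]; rewrite /two_windows yn.
have g'am : mirrored n g' (a + m).
  move=> x /ga[y0 y0a [gy0 gy0']].
  have lex : y0 - a <= n by lia.
  have [y ym [gy gy']] := mirrored_two_windows ltnm lemn lex.
  exists (a + y); first by lia.
  rewrite g'E gy (_ : (a + m).*2 + n - (a + y) = a + (m.*2 + n - y)); last by lia.
  by rewrite g'E gy' -gy0'; split; [rewrite -[RHS]gy0|]; congr g; lia.
exists g'; split=> // i lti; case: (leqP i (a + n)) => lei; last first.
  by exists (a + m); [lia|].
have [b bi [bn gb]] := gcov i lei.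
exists b => //; split; first by lia.
move=> x /gb[y yb [gy gy']]; exists y => //.
by rewrite /g' ifT ?ifT; [split | lia | lia].
Qed.

(** Windows can be shifted successively by any amount between h = ceil ((n + 1) / 2)
    and n + 1, and every number at least h is a sum of such amounts. *)
Lemma exists_mirror_covered n r :
  n.+1 + uphalf n.+1 <= r -> exists g, mirror_covered n g r.
Proof.
move=> ler.
suff ext b : b = 0 \/ uphalf n.+1 <= b ->
    exists g, mirror_covered n g (b + n).+1 /\ mirrored n g b.
  have [|g [gcov _]] := ext (r - n.+1); first by lia.
  by exists g; rewrite (_ : r = (r - n.+1 + n).+1) //; lia.
elim/ltn_ind: b => b IHb [->|leb].
  by exists id; split; [apply: mirror_covered_id | apply: mirrored_id].
(* A shift b < 2h is made at once, being at most n + 1; otherwise a shift by h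
   leaves b - h >= h still to be made. *)
pose m := if b < (uphalf n.+1).*2 then b else uphalf n.+1.
have [||g [gcov ga]] := IHb (b - m).
- by rewrite /m; case: ifP; lia.
- by rewrite /m; case: ifP; lia.
rewrite (_ : b = b - m + m); last by rewrite /m; case: ifP; lia.
by apply: mirror_covered_extend gcov ga; rewrite /m; case: ifP; lia.
Qed.

(** * Coloring a folded grid by antipodal pairs *)

(** If y and y' are mirror images in an interval of length n and i lies in that
    interval, then |i - y| + |i - y'| <= n.  Adding the bounds of both coordinates,
    the two distances total at most 2k + 1, so one of them is at most k. *)
Lemma reflect_within (n1 n2 k a1 a2 i j y1 y2 : nat) :
  n1 + n2 = k.*2.+1 ->
  a1 <= i <= a1 + n1 -> a1 <= y1 <= a1 + n1 ->
  a2 <= j <= a2 + n2 -> a2 <= y2 <= a2 + n2 ->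
  `|i - y1| + `|j - y2| <= k \/
  `|i - (a1.*2 + n1 - y1)%N| + `|j - (a2.*2 + n2 - y2)%N| <= k.
Proof. by lia. Qed.

(** The block has coordinates in [0, n1] x [0, n2].  The two bounds on [k] make the
    ball of the corner (0, 0) of the grid fit in the block. *)
Lemma domatically_full_mirror_covered (n1 n2 k r l : nat) (g1 g2 : nat -> nat) :
  n1 + n2 = k.*2.+1 -> k <= n2 -> minn k r.-1 <= n1 -> 0 < r -> 0 < l ->
  mirror_covered n1 g1 r -> mirror_covered n2 g2 l ->
  domatically_full (@grid r l) k.
Proof.
move=> n12 kn2 kn1 r0 l0 cov1 cov2.
pose x0 : 'I_r * 'I_l := (Ordinal r0, Ordinal l0).
(* The color of y: of the folded point and its antipode in the block, the one at
   distance at most k from the corner.  Colors are vertices of the grid, so the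
   coordinates are cast by [insubd], which is exact on the ball of the corner. *)
pose f (y : 'I_r * 'I_l) : 'I_r * 'I_l :=
  if g1 y.1 + g2 y.2 <= k then (insubd y.1 (g1 y.1), insubd y.2 (g2 y.2))
  else (insubd y.1 (n1 - g1 y.1), insubd y.2 (n2 - g2 y.2)).
apply: (@domatically_full_of_ball _ _ _ x0).
apply: (@domatic_colorable_ball _ _ _ x0 f) => [|[i j] [q1 q2]].
  by rewrite within_grid /manhattan /=; lia.
rewrite within_grid /manhattan /= => q12.
have [lt1 lt2] := (ltn_ord q1, ltn_ord q2).
have [a1 a1i [a1r mir1]] := cov1 i (ltn_ord i).
have [|y1 y1a [gy1 gy1']] := mir1 q1; first by lia.
have [a2 a2j [a2l mir2]] := cov2 j (ltn_ord j).
have [|y2 y2a [gy2 gy2']] := mir2 q2; first by lia.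
(* The color q is met at (y1, y2) and at its antipode in the product of the two
   windows. *)
have [d|d] := reflect_within n12 a1i y1a a2j y2a.
  have y1r : y1 < r by lia.
  have y2l : y2 < l by lia.
  exists (Ordinal y1r, Ordinal y2l); first by rewrite within_grid.
  rewrite /f /= gy1 gy2 ifT; last by lia.
  by congr pair; apply: val_inj; rewrite val_insubd ltn_ord.
have y1r : a1.*2 + n1 - y1 < r by lia.
have y2l : a2.*2 + n2 - y2 < l by lia.
exists (Ordinal y1r, Ordinal y2l); first by rewrite within_grid.
rewrite /f /= gy1' gy2' ifF; last by lia.
have -> : n1 - (n1 - q1) = q1 by lia.
have -> : n2 - (n2 - q2) = q2 by lia.
by congr pair; apply: val_inj; rewrite val_insubd ltn_ord.
Qed.

(* uphalf n is the ceiling of n / 2. *)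
Theorem theorem1p1 (k : nat) (hk : 0 < k) :
  exists E : seq (nat * nat), forall r l : nat,
    0 < r -> 0 < l -> r <= l ->
    r <= k + 2 \/ k + 1 + uphalf (k + 1) <= r ->
    (r, l) \notin E ->
    domatically_full (@grid r l) k.
Proof.
(* N bounds p + ceil (p / 2) for both values p = 2k + 3 - r and p = k + 2 of the
   block length. *)
pose N := 4 * k + 6.
exists [seq (r, l) | r <- iota 0 N, l <- iota 0 N] => r l r0 l0 rl rP rlE.
have Nl : N <= l.
  rewrite leqNgt; apply: contra rlE => lN.
  by apply: allpairs_f; rewrite mem_iota /=; lia.
case: rP => rP.
  have [|g2 cov2] := @exists_mirror_covered (k.*2.+1 - r.-1) l; first by lia.
  apply: (@domatically_full_mirror_covered r.-1 (k.*2.+1 - r.-1) k r l id g2) => //;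
    try lia.
  by rewrite -{2}(prednK r0); apply: mirror_covered_id.
have [|g1 cov1] := @exists_mirror_covered k r; first by lia.
have [|g2 cov2] := @exists_mirror_covered k.+1 l; first by lia.
by apply: (@domatically_full_mirror_covered k k.+1 k r l g1 g2) => //; lia.
Qed.
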